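(* Consider the problem $$r(x)+g(x)\to\min_{x\in\mathbb{R}^n},$$ to be solved with accuracy $\varepsilon>0$ in the function value, where $r,g:\mathbb{R}^n\to\mathbb{R}$ are convex functions whose gradients are Lipschitz with constants $L_r$ and $L_g$ respectively, and at least one of the functions $r,g$ is $\mu$-strongly convex ($\mu>0$). Then the required accuracy can be reached with $$N_r=\tilde O\left(\sqrt{\frac{L_r}{\mu}}\right)$$ computations of the gradient $\nabla r(x)$ and $$N_g=\tilde O\left(\sqrt{\frac{L_g}{\mu}}\right)$$ computations of the gradient $\nabla g(x)$. The result remains true if, instead of $\nabla g(x)$, one uses an $\left(O\left(\frac{\varepsilon}{N_g}\right),O(L_g)\right)$-gradient of $g$.
   Context: Lipschitz continuity and strong convexity are with respect to the Euclidean norm $\|\cdot\|_2$. Accuracy $\varepsilon$ in the function value means finding $\hat x$ with $r(\hat x)+g(\hat x)-\min_{x\in\mathbb{R}^n}(r(x)+g(x))\le\varepsilon$. A $(\delta,L)$-gradient of a convex function $g$ (where $\delta\ge0$, $L>0$) is an oracle which at any requested point $x$ returns a vector $\nabla_\delta g(x)$ for which there is a number $g_\delta(x)$ such that for all $z\in\mathbb{R}^n$ $$0\le g(z)-g_\delta(x)-\langle\nabla_\delta g(x),z-x\rangle\le\frac L2\|z-x\|_2^2+\delta .$$ ''Can be reached with ... computations'' means there is an iterative method that achieves the required accuracy and makes at most the indicated numbers of calls to the indicated gradient oracles. $\tilde O(\cdot)$ means $O(\cdot)$ up to a small power (as a rule 1 or 2) of a logarithmic factor in $\varepsilon$ and the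 parameters of the problem (such as the strong convexity constant and the distance from the starting point to the solution). $O(\cdot)$ in the parameters of the inexact gradient hides numerical constants.
   Formalization: In the bounds N_r and N_g, the square root of L/mu is replaced by the maximum of 1 and that root, since the literal bound is false when L_r/mu or L_g/mu is very small (at least one gradient computation is needed, e.g. for a linear r and a quadratic g). *)

(* Defs.v *)
From HB Require Import structures.
From mathcomp Require Import all_boot all_order all_algebra.
From mathcomp Require Import all_classical all_reals all_analysis.

Set Implicit Arguments.
Unset Strict Implicit.
Unset Printing Implicit Defensive.

Import Order.TTheory GRing.Theory Num.Theory.
Import numFieldNormedType.Exports.

Local Open Scope classical_set_scope.
Local Open Scope ring_scope.

(* The canonical norm of ['rV[R]_n] is the sup norm, so the Euclidean structure
   is defined separately. Differentiability does not depend on this choice,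
   the dimension being finite. *)
Definition dotp (R : realType) (n : nat) (x y : 'rV[R]_n) : R :=
  \sum_(i < n) x ord0 i * y ord0 i.

Definition enorm (R : realType) (n : nat) (x : 'rV[R]_n) : R :=
  Num.sqrt (dotp x x).

Definition grad (R : realType) (n : nat) (f : 'rV[R]_n -> R) (x : 'rV[R]_n)
    : 'rV[R]_n :=
  \row_(i < n) 'd f x (delta_mx ord0 i).

Definition convex (R : realType) (n : nat) (f : 'rV[R]_n -> R) : Prop :=
  @convex_function R 'rV[R]_n [set: 'rV[R]_n] f.

Definition strongly_convex (R : realType) (n : nat) (mu : R)
    (f : 'rV[R]_n -> R) : Prop :=
  forall (x y : 'rV[R]_n) (t : R), 0 <= t <= 1 ->
    f (t *: x + (1 - t) *: y) <=
      t * f x + (1 - t) * f y - mu / 2 * t * (1 - t) * enorm (x - y) ^+ 2.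

Definition smooth (R : realType) (n : nat) (L : R) (f : 'rV[R]_n -> R) : Prop :=
  (forall x, differentiable f x) /\
  (forall x y, enorm (grad f x - grad f y) <= L * enorm (x - y)).

(* [G] is a (delta, L)-gradient of [g]; [gd x] is the number g_delta(x). *)
Definition inexact_gradient (R : realType) (n : nat) (delta L : R)
    (g : 'rV[R]_n -> R) (G : 'rV[R]_n -> 'rV[R]_n) : Prop :=
  forall x, exists gd : R, forall z,
    0 <= g z - gd - dotp (G x) (z - x) <= L / 2 * enorm (z - x) ^+ 2 + delta.

(* Deterministic adaptive methods with two oracles, as well-founded decision
   trees: a node either returns a point, or queries one of the oracles at a
   point and continues according to the answer. Information on the functions
   being minimized is available only through these answers. *)
Inductive method (V : Type) : Type :=
| Return of V
| Query_r of V & (V -> method V)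
| Query_g of V & (V -> method V).

Fixpoint output (V : Type) (Or Og : V -> V) (m : method V) : V :=
  match m with
  | Return x => x
  | Query_r x k => output Or Og (k (Or x))
  | Query_g x k => output Or Og (k (Og x))
  end.

Fixpoint calls_r (V : Type) (Or Og : V -> V) (m : method V) : nat :=
  match m with
  | Return _ => 0
  | Query_r x k => (calls_r Or Og (k (Or x))).+1
  | Query_g x k => calls_r Or Og (k (Og x))
  end.

Fixpoint calls_g (V : Type) (Or Og : V -> V) (m : method V) : nat :=
  match m with
  | Return _ => 0
  | Query_r x k => calls_g Or Og (k (Or x))
  | Query_g x k => (calls_g Or Og (k (Og x))).+1
  end.

(* The data common to all the instances of the problem that a method must
   solve: smoothness and strong convexity constants, accuracy, a bound [D] on
   the distance from the starting point to the solution. *)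
Record params (R : realType) : Type := Params {
  Lr : R; Lg : R; mu : R; eps : R; D : R;
  Lr_gt0 : 0 < Lr; Lg_gt0 : 0 < Lg; mu_gt0 : 0 < mu; eps_gt0 : 0 < eps }.

Definition log_factor (R : realType) (P : params R) : R :=
  1 + ln (1 + (Lr P + Lg P) / mu P + (Lr P + Lg P) * D P ^+ 2 / eps P).

(* [C * sqrt (L / mu) * log ^ p], where sqrt (L / mu) is replaced by 1 when
   L < mu (possible for one of the functions, when the other is strongly
   convex): at least one call is needed even if L / mu is arbitrarily small. *)
Definition Otilde_sqrt (R : realType) (C : R) (p : nat) (P : params R) (L : R)
    : R :=
  C * Num.max 1 (Num.sqrt (L / mu P)) * log_factor P ^+ p.

Definition N_r (R : realType) (C : R) (p : nat) (P : params R) : R :=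
  Otilde_sqrt C p P (Lr P).

Definition N_g (R : realType) (C : R) (p : nat) (P : params R) : R :=
  Otilde_sqrt C p P (Lg P).

Record instance (R : realType) (n : nat) (P : params R) (x0 : 'rV[R]_n)
    (r g : 'rV[R]_n -> R) (xs : 'rV[R]_n) : Prop := Instance {
  convex_r : convex r;
  convex_g : convex g;
  smooth_r : smooth (Lr P) r;
  smooth_g : smooth (Lg P) g;
  strongly_convex_rg : strongly_convex (mu P) r \/ strongly_convex (mu P) g;
  minimizer : forall x, r xs + g xs <= r x + g x;
  distance : enorm (x0 - xs) <= D P }.

(* Run with the oracles [grad r] and [G], the method reaches accuracy [eps]
   within [N_r] calls of the former and [N_g] calls of the latter. *)
Definition succeeds (R : realType) (n : nat) (C : R) (p : nat) (P : params R)
    (r g : 'rV[R]_n -> R) (xs : 'rV[R]_n) (G : 'rV[R]_n -> 'rV[R]_n)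
    (m : method 'rV[R]_n) : Prop :=
  let xhat := output (grad r) G m in
  [/\ r xhat + g xhat - (r xs + g xs) <= eps P,
      (calls_r (grad r) G m)%:R <= N_r C p P &
      (calls_g (grad r) G m)%:R <= N_g C p P].

(* Main.v *)
Require Import Defs.
From mathcomp Require Import all_boot all_order all_algebra.
From mathcomp Require Import all_classical all_reals all_analysis.
From mathcomp Require Import ring lra.

Import Order.TTheory GRing.Theory Num.Theory.
Import numFieldNormedType.Exports.

Local Open Scope ring_scope.

(** Accelerated gradient sliding with restarts. The function with the smaller
    constant, [f], is linearized in an outer accelerated loop; each outer step
    minimizes [<a, x> + h x + L/2 |x - u|^2], where [a] is the gradient of [f] at
    [u], [h] is the other function and [L] the constant of [f], by an inner
    accelerated loop started at [u]. The inner problem is posed in the variable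
    [x = (1 - tau) y + tau z], so it has condition number [M / L] ([M] the constant
    of [h]) at every outer step, and a number of inner steps proportional to
    [sqrt (M / L)], with no logarithm, yields exactly the three-point inequality
    that the outer loop needs, up to a factor 2. No approximate minimizer of the
    subproblem is ever involved, so oracle errors merely add up over the calls.
    With about [sqrt (L / mu)] outer steps, a phase halves the bound on the squared
    distance to the solution, and restarting it costs a single logarithm. *)

(** * Smooth convex functions *)

(** First-order Taylor bound without integration: by hypothesis the derivative of [psi] is
    nonpositive on the open unit interval, so the mean value theorem gives [psi 1 <= psi 0]. *)
Lemma taylor1_le {R : realType} (phi dphi : R -> R) (q : R) :
  (forall t : R, is_derive t (1 : R) phi (dphi t)) ->
  (forall t, 0 < t < 1 -> dphi t - dphi 0 <= q * t) ->
  phi 1 - phi 0 - dphi 0 <= q / 2.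
Proof.
move=> dP bnd.
pose psi := phi - dphi 0 \*: (id : R -> R) - (q / 2) \*: (id : R -> R) ^+ 2.
have dpsi (t : R) : is_derive t (1 : R) psi (dphi t - dphi 0 - q * t).
  apply: is_derive_eq; rewrite /GRing.scale /=.
  by rewrite !mulr1 expr1; congr (_ - _); rewrite mulrA divfK.
have cpsi : continuous psi.
  move=> t; apply: differentiable_continuous; apply/derivable1_diffP.
  exact: (@ex_derive _ _ _ _ _ _ _ (dpsi t)).
have [c] := @MVT R psi _ 0 1 ltr01 (fun t _ => dpsi t) (continuous_subspaceT cpsi).
rewrite in_itv /= => c01; have := bnd c c01.
by rewrite /psi !fctE /= /GRing.scale /=; lra.
Qed.

(** * Euclidean inner product, gradients and the descent lemma *)

Section EuclideanStructure.
Context {R : realType} {n : nat}.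
Implicit Types (x y z : 'rV[R]_n) (f : 'rV[R]_n -> R).

Lemma dotpC x y : dotp x y = dotp y x.
Proof. by apply: eq_bigr => i _; rewrite mulrC. Qed.

Lemma dotpDl x y z : dotp (x + y) z = dotp x z + dotp y z.
Proof. by rewrite -big_split; apply: eq_bigr => i _; rewrite mxE mulrDl. Qed.

Lemma dotpZl (c : R) x y : dotp (c *: x) y = c * dotp x y.
Proof. by rewrite mulr_sumr; apply: eq_bigr => i _; rewrite mxE mulrA. Qed.

Lemma dotpNl x y : dotp (- x) y = - dotp x y.
Proof. by rewrite -scaleN1r dotpZl mulN1r. Qed.

Lemma dotpDr x y z : dotp z (x + y) = dotp z x + dotp z y.
Proof. by rewrite dotpC dotpDl !(dotpC _ z). Qed.

Lemma dotpZr (c : R) x y : dotp x (c *: y) = c * dotp x y.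
Proof. by rewrite dotpC dotpZl dotpC. Qed.

Lemma dotpNr x y : dotp x (- y) = - dotp x y.
Proof. by rewrite dotpC dotpNl dotpC. Qed.

Definition dotpE := (dotpDl, dotpDr, dotpNl, dotpNr, dotpZl, dotpZr).

Lemma dotp_ge0 x : 0 <= dotp x x.
Proof. by apply: sumr_ge0 => i _; rewrite -expr2 sqr_ge0. Qed.

Lemma enorm_ge0 x : 0 <= enorm x.
Proof. exact: sqrtr_ge0. Qed.

Lemma enorm2 x : enorm x ^+ 2 = dotp x x.
Proof. by rewrite sqr_sqrtr ?dotp_ge0. Qed.

(** Cauchy-Schwarz in disguise: expanding [|x - l y|^2 >= 0] gives
    [2 l <x, y> <= |x|^2 + l^2 |y|^2], which is at most [2 l^2 |y|^2]. *)
Lemma dotp_le_of_enorm (l : R) x y :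
  0 < l -> enorm x <= l * enorm y -> dotp x y <= l * dotp y y.
Proof.
move=> l0 xy.
have := dotp_ge0 (x - l *: y); rewrite !dotpE (dotpC y x) => sq_ge0.
have : enorm x ^+ 2 <= (l * enorm y) ^+ 2.
  by rewrite ler_sqr ?nnegrE ?mulr_ge0 ?enorm_ge0 // ltW.
rewrite exprMn !enorm2 => le2.
by rewrite -(ler_pM2l l0); nra.
Qed.

Lemma dotp_grad f x y : differentiable f x -> dotp (grad f x) y = 'd f x y.
Proof.
move=> df; rewrite [in RHS](row_sum_delta y) linear_sum.
by apply: eq_bigr => i _; rewrite linearZ mxE mulrC.
Qed.

Lemma is_derive_line f x d (t : R) : differentiable f (x + t *: d) ->
  is_derive t 1 (fun s : R => f (x + s *: d)) (dotp (grad f (x + t *: d)) d).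
Proof.
move=> df.
(* The difference quotient of the restriction to the line at [t] is that of [f] at [x + t *: d] in
   the direction [d]. *)
have E : (fun h : R => h^-1 *: (f (x + (h *: 1 + t) *: d) - f (x + t *: d)))
   = (fun h : R => h^-1 *: (f (h *: d + (x + t *: d)) - f (x + t *: d))).
  apply/funext => h; congr (_ *: (f _ - _)).
  by rewrite [h *: 1]mulr1 scalerDl addrCA.
apply: DeriveDef.
  by have := @diff_derivable _ _ _ f _ d df; rewrite /derivable /= -E.
by rewrite dotp_grad // -deriveE // /derive -E.
Qed.

(* The case [s = -1] is the lower bound, which holds without convexity. *)
Lemma smooth_quadratic_bound (L : R) f (s : R) x d :
  0 < L -> smooth L f -> `|s| = 1 ->
  s * (f (x + d) - f x - dotp (grad f x) d) <= L / 2 * dotp d d.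
Proof.
move=> L0 [df lip] s1.
pose phi (t : R) := s * f (x + t *: d).
pose dphi (t : R) := s * dotp (grad f (x + t *: d)) d.
have dP (t : R) : is_derive t (1 : R) phi (dphi t).
  have D1 := is_derive_line f x d t (df _).
  exact: (@is_deriveZ _ _ _ _ s _ _ _ D1).
have bnd t : 0 < t < 1 -> dphi t - dphi 0 <= L * dotp d d * t.
  move=> /andP[t0 t1]; rewrite /dphi scale0r addr0 -mulrBr -dotpNl -dotpDl -[s * _]dotpZl.
  rewrite [L * _ * t]mulrAC; apply: dotp_le_of_enorm; first exact: mulr_gt0.
  have -> : enorm (s *: (grad f (x + t *: d) - grad f x)) =
      enorm (grad f (x + t *: d) - grad f x).
    by rewrite /enorm dotpZl dotpZr mulrA -expr2 -real_normK ?num_real // s1 expr1n mul1r.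
  apply: le_trans (lip _ _) _.
  rewrite -mulrA ler_pM2l // [x + _]addrC addrK /enorm dotpZl dotpZr mulrA -expr2.
  by rewrite sqrtrM ?sqr_ge0 // sqrtr_sqr gtr0_norm.
have := taylor1_le phi dphi _ dP bnd.
by rewrite /phi /dphi scale1r scale0r addr0 -!mulrBr [L * _ / 2]mulrAC.
Qed.

Lemma convex_le f (t : R) x y : 0 <= t -> t <= 1 -> convex f ->
  f (t *: x + (1 - t) *: y) <= t * f x + (1 - t) * f y.
Proof.
move=> t0 t1 cf.
by have := cf (Itv01 t0 t1) x y (in_setT _) (in_setT _); rewrite convRE.
Qed.

(** The value [f x] serves as [gd]. The upper bound is the descent lemma. The tangent inequality
    comes from comparing convexity with the lower quadratic bound at a point of the segment close to
    [x]. *)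
Lemma smooth_convex_inexact_gradient (L : R) f (delta : R) :
  0 < L -> 0 <= delta -> convex f -> smooth L f ->
  inexact_gradient delta L f (grad f).
Proof.
move=> L0 d0 cf sf x; exists (f x) => z; apply/andP; split; last first.
  have := smooth_quadratic_bound L f 1 x (z - x) L0 sf (normr1 _).
  by rewrite mul1r [x + _]addrC subrK enorm2 => h; apply: le_trans h _; rewrite lerDl.
rewrite -addrA -opprD subr_ge0; apply/ler_addgt0Pr => e e0.
pose S := L / 2 * dotp (z - x) (z - x).
have S0 : 0 <= S by rewrite mulr_ge0 ?dotp_ge0 // divr_ge0 // ltW.
(* Small enough that the quadratic term, divided by [t], is at most [e]; adding [e] in the
   denominator keeps it positive when [S = 0] and makes [t <= 1]. *)
pose t := e / (S + e).
have t0 : 0 < t by rewrite divr_gt0 // ltr_wpDl.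
have t1 : t <= 1 by rewrite ler_pdivrMr ?mul1r ?ltr_wpDl // lerDr.
have tS : t * S <= e.
  by rewrite /t mulrAC ler_pdivrMr ?ltr_wpDl // ler_wpM2l ?(ltW e0) // lerDl ltW.
have := smooth_quadratic_bound L f (-1) x (t *: (z - x)) L0 sf (normrN1 _).
have := convex_le f t z x (ltW t0) t1 cf.
have -> : t *: z + (1 - t) *: x = x + t *: (z - x).
  by rewrite scalerBl scale1r scalerBr addrCA.
rewrite dotpZr dotpZl dotpZr => h1 h2.
rewrite -(ler_pM2l t0); have : t * (t * S) <= t * e by rewrite ler_pM2l.
rewrite /S; move: h1 h2.
move: (f _) (f z) (f x) (dotp _ _) (dotp _ _) => u1 u2 u3 u4 u5.
clearbody t; clear; lra.
Qed.

End EuclideanStructure.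

(** * Programs with two oracles *)

Section Programs.
Context {V : Type} (Or Og : V -> V).

(* Programs in continuation-passing style, since [method] returns and queries
   points of the same type only. *)
Definition program S := (S -> method V) -> method V.

Definition ask (b : bool) (x : V) : program V :=
  if b then @Query_r V x else @Query_g V x.

Definition oracle (b : bool) : V -> V := if b then Or else Og.

Definition calls (b : bool) (m : method V) : nat :=
  if b then calls_r Or Og m else calls_g Or Og m.

(** Total correctness: with the oracles fixed, the program hands one result [s] to every
    continuation, and [N] is the exact number of calls it makes, not only a bound. *)
Definition hoare {S : Type} (c : program S) (Q : S -> Prop) (N : bool -> nat) :=
  exists2 s, Q s & forall k,
    output Or Og (c k) = output Or Og (k s) /\
    forall b, calls b (c k) = (N b + calls b (k s))%N.

Lemma hoare_ask {S : Type} (b : bool) (x : V) (c : V -> program S) Q N :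
  hoare (c (oracle b x)) Q N ->
  hoare (fun k => ask b x (fun a => c a k)) Q (fun b' => (b' == b) + N b')%N.
Proof.
move=> [s Qs cP]; exists s => // k; have [outE ncE] := cP k; clear cP Qs.
split; first by case: (b) outE => /= ->.
by case: (b) ncE => ncE b'; have := ncE b'; case: b' => /= ->; rewrite ?addnA.
Qed.

Lemma hoare_bind {S S' : Type} (c : program S) (c' : S -> program S') P Q N N' :
  hoare c P N -> (forall s, P s -> hoare (c' s) Q N') ->
  hoare (fun k => c (fun s => c' s k)) Q (fun b => N b + N' b)%N.
Proof.
move=> [s Ps cP] /(_ s Ps)[s' Qs' cP']; exists s' => // k.
have [outE ncE] := cP (fun s => c' s k); have [outE' ncE'] := cP' k.
by split=> [|b]; [rewrite outE outE' | rewrite ncE ncE' addnA].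
Qed.

Lemma hoare_ret {S : Type} (s : S) (Q : S -> Prop) :
  Q s -> hoare (fun k => k s) Q (fun=> 0%N).
Proof. by move=> Qs; exists s. Qed.

Lemma hoare_weaken {S : Type} (c : program S) (Q Q' : S -> Prop) N N' :
  hoare c Q N -> (forall s, Q s -> Q' s) -> N =1 N' -> hoare c Q' N'.
Proof.
move=> [s Qs cP] QQ' NN'; exists s => [|k]; first exact: QQ'.
by have [outE ncE] := cP k; split=> // b; rewrite ncE NN'.
Qed.

Fixpoint loop {S : Type} (body : nat -> S -> program S) (n i : nat) (s : S)
    : program S :=
  if n is n'.+1 then fun k => body i s (fun s' => loop body n' i.+1 s' k)
  else fun k => k s.

Lemma hoare_loop {S : Type} (body : nat -> S -> program S) (I : nat -> S -> Prop) N :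
  (forall i s, I i s -> hoare (body i s) (I i.+1) N) ->
  forall n s, I 0 s -> hoare (loop body n 0 s) (I n) (fun b => n * N b)%N.
Proof.
move=> bodyP n s.
suff gen i s' : I i s' -> hoare (loop body n i s') (I (i + n)%N) (fun b => n * N b)%N.
  exact: gen.
elim: n i s' => [|n IHn] i s' Is; first by rewrite addn0; exact: hoare_ret.
rewrite -addSnnS; apply: hoare_bind (bodyP _ _ Is) _ => s'' Is''; exact: IHn.
Qed.

End Programs.

(** * Accelerated gradient sliding *)

Section Sliding.
Context {R : realType} {n : nat}.
Local Notation V := 'rV[R]_n.
Implicit Types (a s u v w x y z g : V) (f h : V -> R).

(** The hypothesis says that [z'] is a stationary point of the quadratic function of [x] on the
    right; its expansion about [z'] has no linear term. *)
Lemma prox_identity (b e : R) u z g z' x :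
  (b + e) *: z' = b *: u + e *: z - g ->
  dotp g z' + b / 2 * dotp (z' - u) (z' - u) + e / 2 * dotp (z' - z) (z' - z)
    + (b + e) / 2 * dotp (x - z') (x - z') =
  dotp g x + b / 2 * dotp (x - u) (x - u) + e / 2 * dotp (x - z) (x - z).
Proof.
move=> z'E; have -> : g = b *: u + e *: z - (b + e) *: z'.
  by rewrite z'E opprB addrCA subrr addr0.
rewrite !dotpE (dotpC z' u) (dotpC z' z) (dotpC x u) (dotpC x z) (dotpC z' x).
by field.
Qed.

Lemma sqdist_convex (t : R) u x y : 0 <= t <= 1 ->
  dotp ((1 - t) *: x + t *: y - u) ((1 - t) *: x + t *: y - u)
    <= (1 - t) * dotp (x - u) (x - u) + t * dotp (y - u) (y - u).
Proof.
move=> /andP[t0 t1].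
have : 0 <= t * (1 - t) * dotp (x - y) (x - y).
  by rewrite mulr_ge0 ?dotp_ge0 // mulr_ge0 // subr_ge0.
rewrite !dotpE (dotpC x u) (dotpC y u) (dotpC y x).
move: (dotp x x) (dotp u x) (dotp x y) (dotp u y) (dotp y y) (dotp u u).
by clear; move=> *; lra.
Qed.

Definition prox_objective h a (b : R) u x : R :=
  dotp a x + h x + b / 2 * dotp (x - u) (x - u).

(** The new point differs from the query point by [t *: (z' - z)], so the smoothness term
    [M t^2 / 2 |z' - z|^2] is absorbed by the proximal term as [M * t <= e]. The lower bounds at [s]
    and [x] have weights [1 - t] and [t], so the unknown number [hp] cancels and [delta] is paid
    only once, in the upper bound. *)
Lemma prox_step h G (delta M b e t : R) a u s z z' x :
  inexact_gradient delta M h G -> 0 <= b -> 0 <= t <= 1 -> M * t <= e ->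
  (b + e) *: z' = b *: u + e *: z - (a + G ((1 - t) *: s + t *: z)) ->
  prox_objective h a b u ((1 - t) *: s + t *: z') - prox_objective h a b u x <=
    (1 - t) * (prox_objective h a b u s - prox_objective h a b u x)
    + t * (e / 2 * dotp (x - z) (x - z) - (b + e) / 2 * dotp (x - z') (x - z'))
    + delta.
Proof.
move=> hG b0 t01 Mte z'E; rewrite /prox_objective.
have /andP[t0 t1] := t01.
have := prox_identity b e u z _ z' x z'E.
set p := (1 - t) *: s + t *: z; set g := G p.
have [hp hP] := hG p.
have /andP[_ up] := hP ((1 - t) *: s + t *: z').
have /andP[lo_s _] := hP s; have /andP[lo_x _] := hP x.
rewrite enorm2 -/g in up; rewrite -/g in lo_s lo_x.
have pE : (1 - t) *: s + t *: z' - p = t *: (z' - z).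
  by rewrite /p opprD addrACA subrr add0r scalerBr.
have dotpB w q q' : dotp w (q - q') = dotp w q - dotp w q' by rewrite dotpDr dotpNr.
have conv_u := sqdist_convex t u s z' t01.
have pE2 : dotp g p = (1 - t) * dotp g s + t * dotp g z.
  by rewrite dotpDr !dotpZr.
rewrite pE (dotpZl t (z' - z)) !dotpZr dotpB in up.
rewrite dotpB pE2 in lo_s; rewrite dotpB pE2 in lo_x.
rewrite (dotpDl a g z') (dotpDl a g x) (dotpDr _ _ a) !dotpZr.
have prox_gap : 0 <= t * (e - M * t) * dotp (z' - z) (z' - z).
  by rewrite mulr_ge0 ?dotp_ge0 // mulr_ge0 // subr_ge0.
have {}conv_u : b * _ <= b * _ := ler_wpM2l b0 conv_u.
have {}lo_s := mulr_ge0 (etrans (subr_ge0 _ _) t1) lo_s.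
have {}lo_x := mulr_ge0 t0 lo_x.
move: up lo_s lo_x conv_u prox_gap.
move: (dotp g z) (dotp g s) (dotp g x) (dotp g z') (dotp a s) (dotp a x) (dotp a z').
move: (dotp (s - u) _) (dotp (x - u) _) (dotp (z' - u) _) (dotp (z' - z) _).
move: (dotp _ _) (dotp _ _) (dotp (_ - u) _) (h _) (h s) (h x).
move=> q1 q2 q3 q4 q5 q6 q7 q8 q9 q10 q11 q12 q13 q14 q15 q16 q17.
move=> up lo_s lo_x conv_u prox_gap /(congr1 ( *%R t)) id_t.
lra.
Qed.
End Sliding.

(** * The inner loop, the outer loop and the restarts *)

Section Methods.
Context {R : realType} {n : nat}.
Local Notation V := 'rV[R]_n.
Implicit Types (a s u v w x y z : V) (f h : V -> R).

(** Nesterov's weights; [tau 0 = 1], so the first step discards the gap at the starting point. *)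
Definition tau (t : nat) : R := 2 / (t%:R + 2).

Lemma tau_itv t : 0 <= tau t <= 1.
Proof.
have t0 : 0 <= t%:R :> R by [].
by rewrite divr_ge0 ?addr_ge0 //= ler_pdivrMr ?mul1r ?lerDr // ltr_wpDl.
Qed.

(** With [A t = t (t + 1) / 2], this value [e] satisfies [(t + 1) e = 2 M + L A t] and
    [(t + 1) (L + e) = 2 M + L A t.+1], so weighted proximal terms telescope. The summand [2 * M]
    ensures [M * tau t <= e]. *)
Definition prox_weight (L M : R) (t : nat) : R :=
  (2 * M + L * (t%:R * (t%:R + 1) / 2)) / (t%:R + 1).

(* Accelerated minimization of [prox_objective h a L u], whose quadratic part
   is kept in the proximal steps; [q] selects the oracle for [h]. *)
Definition prox_body (q : bool) (L M : R) a u (t : nat) (sz : V * V) : program (V * V) :=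
  let e := prox_weight L M t in
  let next z' := ((1 - tau t) *: sz.1 + tau t *: z', z') in
  fun k => ask q ((1 - tau t) *: sz.1 + tau t *: sz.2)
    (fun G => k (next ((L + e)^-1 *: (L *: u + e *: sz.2 - (a + G))))).

Definition prox_method q L M (T : nat) a u := loop (prox_body q L M a u) T 0 (u, u).

(** The inner proximal center lives in the variable [(1 - tau k) *: y + tau k *: v]; the second
    component of the new state solves for [v]. *)
Definition sliding_body (q : bool) (L M : R) T (k : nat) (yv : V * V) : program (V * V) :=
  let u := (1 - tau k) *: yv.1 + tau k *: yv.2 in
  fun c => ask q u (fun a => prox_method (~~ q) L M T a u
    (fun sw => c (sw.1, (tau k)^-1 *: (sw.2 - (1 - tau k) *: yv.1)))).

Definition sliding_method q L M T K x := loop (sliding_body q L M T) K 0 (x, x).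

Definition restarted_method q L M T K J x0 : method V :=
  loop (fun _ x c => sliding_method q L M T K x (fun yv => c yv.1)) J 0 x0
    (@Return V).

Definition prox_rate (M : R) (T : nat) : R := 4 * M / (T%:R * (T%:R + 1)).

Context {Or Og : V -> V}.
Local Notation hoare := (hoare Or Og).
Local Notation oracle := (oracle Or Og).

(** An exact minimizer would satisfy this with rate 0 and no error. The rate is added to the
    coefficients of both squared distances alike, so the inequality still telescopes in the outer
    loop. *)
Lemma prox_methodP q (L M delta : R) (T : nat) a u h :
  0 < L -> 0 < M -> 0 <= delta -> (0 < T)%N ->
  inexact_gradient delta M h (oracle q) ->
  hoare (prox_method q L M T a u)
    (fun sw => forall x, prox_objective h a L u sw.1 <= prox_objective h a L u x
        + prox_rate M T / 2 * dotp (x - u) (x - u)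
        - (L + prox_rate M T) / 2 * dotp (x - sw.2) (x - sw.2) + T%:R * delta)
    (fun b => T * (b == q))%N.
Proof.
move=> L0 M0 d0 T0 hG.
pose A (t : nat) : R := t%:R * (t%:R + 1) / 2.
(* At [t = 0] the weight [A 0] vanishes and the distance terms cancel. The errors [A i * delta] up
   to step [t] sum to at most [t * A t * delta], since [A] increases. *)
pose I (t : nat) (sw : V * V) := forall x,
  A t * (prox_objective h a L u sw.1 - prox_objective h a L u x) <=
    M * dotp (x - u) (x - u) - (2 * M + L * A t) / 2 * dotp (x - sw.2) (x - sw.2)
    + t%:R * A t * delta.
have T0' : 0 < T%:R :> R by rewrite ltr0n.
have AT0 : 0 < A T by rewrite /A divr_gt0 // mulr_gt0 // addr_gt0.
have -> : prox_rate M T = 2 * M / A T.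
  by rewrite /prox_rate /A; field; rewrite !gt_eqF ?addr_gt0.
apply: (@hoare_weaken _ _ _ _ _ (I T) _ (fun b => T * ((b == q) + 0))%N) => //.
- apply: hoare_loop => [t [s z] Isz|].
    apply: hoare_ask; apply: hoare_ret => /=.
    set e := prox_weight L M t; set z' := _^-1 *: _ => x /=.
    have t0 : 0 <= t%:R :> R by [].
    have t10 : 0 < t%:R + 1 :> R by rewrite ltr_wpDl.
    have t20 : 0 < t%:R + 2 :> R by rewrite ltr_wpDl.
    have At0 : 0 <= A t by rewrite /A divr_ge0 // mulr_ge0 // addr_ge0.
    have eE : (t%:R + 1) * e = 2 * M + L * A t by rewrite mulrC divfK ?gt_eqF.
    have e0 : 0 < e by rewrite divr_gt0 // ltr_pwDl ?mulr_gt0 // mulr_ge0 // ltW.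
    have Mte : M * tau t <= e.
      rewrite -(ler_pM2l t10) eE /tau.
      have : (t%:R + 1) * (M * (2 / (t%:R + 2))) <= 2 * M.
        rewrite -(ler_pM2r t20) -!mulrA mulVf ?gt_eqF // mulr1.
        nra.
      by move=> /le_trans; apply; rewrite lerDl mulr_ge0 // ltW.
    have z'E : (L + e) *: z' =
        L *: u + e *: z - (a + oracle q ((1 - tau t) *: s + tau t *: z)).
      by rewrite /z' scalerKV // gt_eqF // addr_gt0.
    have step := prox_step h (oracle q) delta M L e (tau t) a u s z z' x hG
      (ltW L0) (tau_itv t) Mte z'E.
    (* This is [A t.+1]. Multiplied by it, the weights [1 - tau t] and [tau t] of the step become
       [A t] and [t + 1]. *)
    pose A' : R := (t%:R + 1) * (t%:R + 2) / 2.
    have A'0 : 0 <= A' by rewrite divr_ge0 // mulr_ge0 // ltW.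
    have A'tau : A' * tau t = t%:R + 1 by rewrite /A' /tau; field; rewrite gt_eqF.
    have A't : A' * (1 - tau t) = A t by rewrite mulrBr A'tau /A' /A; lra.
    have AS : A t.+1 = A' by rewrite /A /A' -natr1; lra.
    have := ler_wpM2l A'0 step.
    have expand X Y : A' * ((1 - tau t) * X + tau t * Y + delta) =
        A t * X + (t%:R + 1) * Y + A' * delta by rewrite -A't -A'tau; ring.
    rewrite {}expand -AS.
    have := Isz x; rewrite /= -[t.+1%:R]natr1.
    have AtS : A t.+1 = A t + (t%:R + 1) by rewrite AS /A' /A; lra.
    have dA : 0 <= t%:R * ((t%:R + 1) * delta) by rewrite !mulr_ge0 // ltW.
    rewrite AtS.
    move: (prox_objective _ _ _ _ _) (prox_objective _ _ _ _ x) (prox_objective _ _ _ _ _).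
    move: (dotp _ _) (dotp _ _) (dotp _ _) => D1 D2 D3 P1 P2 P3.
    have eD1 := congr1 ( *%R^~ D1) eE; have eD2 := congr1 ( *%R^~ D2) eE.
    rewrite /= in eD1 eD2; lra.
  by move=> x /=; rewrite /A; lra.
- move=> [s w] Isw x; rewrite -(ler_pM2l AT0); have := Isw x; rewrite /=.
  move: (prox_objective _ _ _ _ _) (prox_objective _ _ _ _ x) (dotp _ _) (dotp _ _).
  move=> P1 P2 D1 D2.
  have -> : A T * (P2 + 2 * M / A T / 2 * D2 - (L + 2 * M / A T) / 2 * D1 + T%:R * delta)
     = A T * P2 + M * D2 - (2 * M + L * A T) / 2 * D1 + T%:R * A T * delta.
    by field; rewrite gt_eqF.
  lra.
- by move=> b; rewrite addn0.
Qed.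

(** The inner inequality is tested at [x = (1 - tau k) *: y + tau k *: xs]: its differences with [u]
    and [w] are [tau k] times those of [xs] with [v] and [v'], whence the factor [tau k ^+ 2]. The
    oracle of [f] bounds its linearization from above at the new point and from below at [y] and
    [xs]. *)
Lemma sliding_bodyP q (L M df dh : R) T k f h xs y v :
  0 < L -> 0 < M -> 0 <= dh -> (0 < T)%N -> convex h ->
  inexact_gradient df L f (oracle q) -> inexact_gradient dh M h (oracle (~~ q)) ->
  hoare (sliding_body q L M T k (y, v))
    (fun yv => f yv.1 + h yv.1 - (f xs + h xs) <=
        (1 - tau k) * (f y + h y - (f xs + h xs))
        + tau k ^+ 2 * ((L + prox_rate M T) / 2)
          * (dotp (xs - v) (xs - v) - dotp (xs - yv.2) (xs - yv.2))
        + (df + T%:R * dh))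
    (fun b => if b == q then 1 else T)%N.
Proof.
move=> L0 M0 dh0 T0 ch fG hG.
have T0' : 0 < T%:R :> R by rewrite ltr0n.
have tau0 : 0 < tau k by rewrite divr_gt0 // ltr_wpDl.
have /andP[_ tau1] := tau_itv k.
apply: (hoare_weaken _ _ _ _ _ (fun b => (b == q) + (T * (b == ~~ q) + 0))%N
  _ _ (fun=> id)); last first.
- by move=> b; case: b; case: q {fG hG}; rewrite /= ?muln0 ?muln1 ?addn0.
- rewrite /sliding_body; apply: hoare_ask.
  set u := (1 - tau k) *: _ + tau k *: _.
  apply: hoare_bind (prox_methodP _ L M dh T _ u h L0 M0 dh0 T0 hG) _ => -[s w] /= sw.
  apply: hoare_ret => /=.
  move: sw; set a := oracle q u; set v' := _^-1 *: _ => sw.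
  pose x := (1 - tau k) *: y + tau k *: xs.
  have xu : x - u = tau k *: (xs - v).
    by rewrite /x /u /= opprD addrACA subrr add0r scalerBr.
  have xw : x - w = tau k *: (xs - v').
    rewrite scalerBr scalerKV ?gt_eqF // opprB /x.
    by rewrite addrCA addrA.
  have hx : h x <= (1 - tau k) * h y + tau k * h xs.
    by rewrite /x addrC [X in _ <= X]addrC; apply: convex_le (ltW tau0) tau1 ch.
  have {sw} := sw x; rewrite /prox_objective xu xw !dotpZl !dotpZr.
  have [fu fP] := fG u.
  have /andP[_ up] := fP s; have /andP[lo_y _] := fP y; have /andP[lo_x _] := fP xs.
  rewrite enorm2 in up.
  have dotpB q1 q2 : dotp a (q1 - q2) = dotp a q1 - dotp a q2 by rewrite dotpDr dotpNr.
  rewrite -/a !dotpB in up lo_y lo_x.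
  have xE : dotp a x = (1 - tau k) * dotp a y + tau k * dotp a xs.
    by rewrite dotpDr !dotpZr.
  rewrite xE.
  have {}lo_y := mulr_ge0 (etrans (subr_ge0 _ _) tau1) lo_y.
  have {}lo_x := mulr_ge0 (ltW tau0) lo_x.
  move: up lo_y lo_x hx.
  move: (dotp a u) (dotp a y) (dotp a xs) (dotp a s).
  move: (dotp (s - u) _) (dotp (xs - v) _) (dotp (xs - v') _).
  move: (h x) (h y) (h xs) (h s) (f y) (f xs) (f s) => *.
  lra.
Qed.

(** Divided by [tau k ^+ 2], the outer steps telescope; lowering the coefficient of the new gap to
    [W k.+1] uses that the gap is nonnegative. The bound on the rate gives [ka <= 2 * L]. *)
Lemma sliding_methodP q (L M df dh : R) T K f h xs x0 :
  0 < L -> 0 < M -> 0 <= df -> 0 <= dh -> (0 < T)%N -> (0 < K)%N ->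
  prox_rate M T <= L -> convex h -> (forall x, f xs + h xs <= f x + h x) ->
  inexact_gradient df L f (oracle q) -> inexact_gradient dh M h (oracle (~~ q)) ->
  hoare (sliding_method q L M T K x0)
    (fun yv => f yv.1 + h yv.1 - (f xs + h xs) <=
        4 * L / (K%:R * (K%:R + 2)) * dotp (xs - x0) (xs - x0)
        + 2 * K%:R * (df + T%:R * dh))
    (fun b => K * if b == q then 1 else T)%N.
Proof.
move=> L0 M0 df0 dh0 T0 K0 rateL ch min fG hG.
set E := df + T%:R * dh; set ka := L + prox_rate M T.
have E0 : 0 <= E by rewrite addr_ge0 // mulr_ge0.
(* [W k = (1 - tau k) / tau k ^+ 2], which is at most [1 / tau (k - 1) ^+ 2]. *)
pose W (k : nat) : R := k%:R * (k%:R + 2) / 4.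
pose I (k : nat) (yv : V * V) :=
  W k * (f yv.1 + h yv.1 - (f xs + h xs)) + ka / 2 * dotp (xs - yv.2) (xs - yv.2)
    <= ka / 2 * dotp (xs - x0) (xs - x0) + 2 * k%:R * W k * E.
have K0' : 0 < K%:R :> R by rewrite ltr0n.
have WK0 : 0 < W K by rewrite /W divr_gt0 // mulr_gt0 // addr_gt0.
have rate0 : 0 <= prox_rate M T.
  by rewrite divr_ge0 ?mulr_ge0 ?addr_ge0 // ltW.
apply: (hoare_weaken _ _ _ (I K) _ (fun b => K * if b == q then 1 else T)%N) => //.
  apply: (hoare_loop _ _ _ I (fun b => if b == q then 1 else T)%N)
    => [k [y v] Ikyv|]; last by rewrite /I /W /=; lra.
  apply: (hoare_weaken _ _ _ _ _ _ _
    (sliding_bodyP _ _ _ _ _ T k _ _ xs y v L0 M0 dh0 T0 ch fG hG)) => //.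
  move=> [y' v'] /= step; move: Ikyv; rewrite /I /=.
  rewrite -/E -/ka in step.
  have := min y'; rewrite -subr_ge0.
  move: step; move: (f y' + h y' - _) (f y + _ - _) (dotp _ _) (dotp _ _) (dotp _ _).
  move=> e1 e0 D0 D2 D1.
  have k0 : 0 <= k%:R :> R by [].
  have k20 : 0 < k%:R + 2 :> R by rewrite ltr_wpDl.
  pose B : R := (k%:R + 2) ^+ 2 / 4.
  have B0 : 0 <= B by rewrite divr_ge0 // sqr_ge0.
  have Btau2 : B * tau k ^+ 2 = 1 by rewrite /B /tau; field; rewrite gt_eqF.
  have Btau : B * (1 - tau k) = W k by rewrite /B /tau /W; field; rewrite gt_eqF.
  move=> /(ler_wpM2l B0).
  have -> : B * ((1 - tau k) * e0 + tau k ^+ 2 * (ka / 2) * (D1 - D2) + E)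
     = W k * e0 + ka / 2 * (D1 - D2) + B * E.
    by rewrite -Btau -[ka / 2 * (D1 - D2) in RHS]mul1r -Btau2; ring.
  move=> step e1ge0 Ik.
  have WB : W k.+1 * e1 <= B * e1.
    by rewrite ler_wpM2r // /W /B -[k.+1%:R]natr1; nra.
  (* [B] exceeds [W k.+1] by 1/4 but is at most [2 * W k.+1], hence the factor 2 in the error term
     of [I]. *)
  have WE : 2 * k%:R * W k * E + B * E <= 2 * k.+1%:R * W k.+1 * E.
    rewrite -mulrDl ler_wpM2r // /W /B -[k.+1%:R]natr1; nra.
  lra.
move=> [y v]; rewrite /I /= => Iy; rewrite -(ler_pM2l WK0).
have -> D : W K * (4 * L / (K%:R * (K%:R + 2)) * D + 2 * K%:R * E) =
    L * D + 2 * K%:R * W K * E.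
  by rewrite /W; field; rewrite !gt_eqF ?addr_gt0.
have := dotp_ge0 (xs - x0); have := dotp_ge0 (xs - v); move: Iy.
move: (f y + _ - _) (dotp _ _) (dotp _ _) => e0 D2 D1 Iy D10 D20.
have : ka * D2 <= 2 * L * D2 by rewrite ler_wpM2r // /ka; lra.
have : 0 <= ka * D1 by rewrite mulr_ge0 // /ka addr_ge0 // ltW.
lra.
Qed.

(** Minimality is tested only at the midpoint of [xs] and [x]; this gives [m / 4] in place of the
    sharp [m / 2] but takes no limit. *)
Lemma strongly_convex_quadratic_growth (m : R) f h xs x : convex f -> convex h ->
  strongly_convex m f \/ strongly_convex m h ->
  (forall x, f xs + h xs <= f x + h x) ->
  m / 4 * dotp (xs - x) (xs - x) <= f x + h x - (f xs + h xs).
Proof.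
move=> cf ch sc min.
have h0 : 0 <= 2^-1 :> R by rewrite invr_ge0.
have h1 : 2^-1 <= 1 :> R by rewrite invf_le1 // ler1n.
have := min (2^-1 *: xs + (1 - 2^-1) *: x).
have := convex_le f 2^-1 xs x h0 h1 cf; have := convex_le h 2^-1 xs x h0 h1 ch.
case: sc => /(_ xs x 2^-1 (introT andP (conj h0 h1))); rewrite enorm2.
  by move: (f (_ + _)) (h (_ + _)) (dotp _ _) => *; lra.
by move: (f (_ + _)) (h (_ + _)) (dotp _ _) => *; lra.
Qed.

(** The condition on [K] makes the gap after a phase at most [m / 8] times the squared distance
    before it, plus errors; quadratic growth with constant [m / 4] turns this into halving. *)
Lemma restarted_methodP q (L M m df dh D : R) T K J f h xs x0 :
  0 < L -> 0 < M -> 0 < m -> 0 <= df -> 0 <= dh ->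
  (0 < T)%N -> (0 < K)%N -> (0 < J)%N ->
  prox_rate M T <= L -> 32 * L <= m * (K%:R * (K%:R + 2)) ->
  convex f -> convex h -> strongly_convex m f \/ strongly_convex m h ->
  (forall x, f xs + h xs <= f x + h x) -> enorm (x0 - xs) <= D ->
  inexact_gradient df L f (oracle q) -> inexact_gradient dh M h (oracle (~~ q)) ->
  let meth := restarted_method q L M T K J x0 in
  let x := output Or Og meth in
  f x + h x - (f xs + h xs) <=
      m / 4 * (D ^+ 2 / 2 ^+ J) + 4 * K%:R * (df + T%:R * dh) /\
  forall b, calls Or Og b meth = (J * (K * if b == q then 1 else T))%N.
Proof.
move=> L0 M0 m0 df0 dh0 T0 K0 J0 rateL KL cf ch sc min x0D fG hG /=.
set E := df + T%:R * dh.
have E0 : 0 <= E by rewrite addr_ge0 // mulr_ge0.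
(* Solves [X j.+1 = X j / 2 + 8 K E / m], whose fixed point is [16 K E / m]: phase errors add up
   geometrically, whatever the number of phases. *)
pose X (j : nat) : R := D ^+ 2 / 2 ^+ j + 16 * K%:R * E / m.
(* The gap at [x0] is not assumed bounded, so the second bound starts after the first phase. *)
pose I (j : nat) x := dotp (xs - x) (xs - x) <= X j /\
  ((0 < j)%N -> f x + h x - (f xs + h xs) <= m / 4 * X j).
have K0' : 0 < K%:R :> R by rewrite ltr0n.
have I0 : I 0%N x0.
  split=> //; rewrite /X expr0 divr1 -(opprB x0) dotpNl dotpNr opprK -enorm2.
  have : enorm (x0 - xs) ^+ 2 <= D ^+ 2.
    by rewrite ler_sqr // nnegrE ?enorm_ge0 // (le_trans (enorm_ge0 _) x0D).
  by move/le_trans; apply; rewrite lerDl divr_ge0 ?mulr_ge0 // ltW.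
have [x [_ Jx] xP] : hoare
    (loop (fun _ x c => sliding_method q L M T K x (fun yv => c yv.1)) J 0 x0)
    (I J) (fun b => J * (K * if b == q then 1 else T))%N.
  apply: (hoare_loop _ _ _ I (fun b => K * if b == q then 1 else T)%N) => // j x [dx _].
  apply: (hoare_weaken _ _ _ _ _ (fun b => K * (if b == q then 1 else T) + 0)%N
    _ _ (fun=> id)).
    apply: hoare_bind (sliding_methodP q L M df dh T K f h xs x L0 M0 df0 dh0 T0 K0
      rateL ch min fG hG) _.
    move=> [y v] /= gap_y; apply: hoare_ret => /=.
    rewrite -/E in gap_y.
    have KK0 : 0 < K%:R * (K%:R + 2) :> R by rewrite mulr_gt0 // addr_gt0.
    have rate8 : 4 * L / (K%:R * (K%:R + 2)) <= m / 8 by rewrite ler_pdivrMr //; lra.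
    have gap_X : f y + h y - (f xs + h xs) <= m / 4 * X j.+1.
      apply: le_trans gap_y _.
      have -> : m / 4 * X j.+1 = m / 8 * X j + 2 * K%:R * E.
        by rewrite /X [2 ^+ j.+1]exprS; field; rewrite gt_eqF //= expf_neq0.
      by rewrite lerD2r; apply: ler_pM => //; rewrite ?dotp_ge0 // divr_ge0 ?mulr_ge0 // ltW.
    split=> //; have := strongly_convex_quadratic_growth m f h xs y cf ch sc min.
    by move=> /le_trans/(_ gap_X); rewrite ler_pM2l // divr_gt0.
  by move=> b; rewrite addn0.
have [outE callE] := xP (@Return V); rewrite /restarted_method outE.
split; last by move=> b; rewrite callE; case: (b); rewrite addn0.
apply: le_trans (Jx J0) _; rewrite /X mulrDr lerD2l.
by rewrite le_eqVlt; apply/orP; left; apply/eqP; field; rewrite gt_eqF.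
Qed.

End Methods.

(** * Choice of the parameters *)

Section Tuning.
Context {R : realType} {n : nat}.
Local Notation V := 'rV[R]_n.
Implicit Types (f h : V -> R) (x y : V) (P : params R).

(** Being a successor, it makes every step count positive by computation. *)
Definition nat_above (x : R) : nat := (Num.truncn x).+1.

Lemma nat_aboveP (x y : R) : 0 <= x -> 1 <= y ->
  x <= (nat_above x)%:R <= x + y.
Proof.
move=> x0 y1; have /andP[lo hi] := truncn_itv x0.
by rewrite (ltW hi) /nat_above -natr1 lerD.
Qed.

(* [a] and [b] stand for the square roots of the two condition numbers, so that
   no square root occurs in the step counts. *)
Definition tuned_method q (m a b l : R) (x0 : V) : method V :=
  restarted_method q (m * a ^+ 2) (m * b ^+ 2)
    (nat_above (2 * (b / a))) (nat_above (6 * a)) (nat_above (2 * l)) x0.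

(** [T >= 2 b / a] makes the inner rate at most [m a^2], and [K >= 6 a] gives [K^2 >= 36 a^2].
    Rounding adds at most 1, absorbed by [b / a], [a] and [l], so [a T <= 3 b], [K <= 7 a] and
    [J <= 3 l]; the numerical constants are products of these. *)
Lemma tuned_methodP Or Og q (m a b l df dh D : R) f h xs x0 :
  0 < m -> 1 <= a -> a <= b -> 1 <= l -> 0 <= df -> 0 <= dh ->
  convex f -> convex h -> strongly_convex m f \/ strongly_convex m h ->
  (forall x, f xs + h xs <= f x + h x) -> enorm (x0 - xs) <= D ->
  inexact_gradient df (m * a ^+ 2) f (oracle Or Og q) ->
  inexact_gradient dh (m * b ^+ 2) h (oracle Or Og (~~ q)) ->
  let meth := tuned_method q m a b l x0 in
  let x := output Or Og meth in
  [/\ f x + h x - (f xs + h xs) <=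
        m / 4 * (D ^+ 2 / 2 ^+ nat_above (2 * l)) + (28 * a * df + 84 * b * dh),
      (calls Or Og q meth)%:R <= 21 * a * l &
      (calls Or Og (~~ q) meth)%:R <= 63 * b * l].
Proof.
move=> m0 a1 ab l1 df0 dh0 cf ch sc min x0D fG hG.
rewrite /tuned_method; set J := nat_above (2 * l).
set K := nat_above (6 * a); set T := nat_above (2 * (b / a)).
have a0 : 0 < a by apply: lt_le_trans a1.
have b0 : 0 < b by apply: lt_le_trans ab.
have ba1 : 1 <= b / a by rewrite ler_pdivlMr // mul1r.
have /andP[K6 K7] : 6 * a <= K%:R <= 6 * a + a by rewrite nat_aboveP ?mulr_ge0 // ltW.
have /andP[T2 T3] : 2 * (b / a) <= T%:R <= 2 * (b / a) + b / a.
  by rewrite nat_aboveP // mulr_ge0 // (le_trans ler01).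
have /andP[_ J3] : 2 * l <= J%:R <= 2 * l + l.
  by rewrite nat_aboveP // mulr_ge0 // (le_trans ler01).
have aT : 2 * b <= a * T%:R.
  by rewrite [a * _]mulrC -ler_pdivrMr // -mulrA.
have aT3 : a * T%:R <= 3 * b.
  rewrite [a * _]mulrC -ler_pdivlMr // (le_trans T3) // -[3 * b / a]mulrA; lra.
have KT : K%:R * T%:R <= 21 * b.
  have : K%:R * T%:R <= (7 * a) * T%:R by rewrite ler_wpM2r //; lra.
  lra.
have T0 : 0 <= T%:R :> R by [].
have L0 : 0 < m * a ^+ 2 by rewrite mulr_gt0 ?exprn_gt0.
have M0 : 0 < m * b ^+ 2 by rewrite mulr_gt0 ?exprn_gt0.
have rateL : prox_rate (m * b ^+ 2) T <= m * a ^+ 2.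
  have Tpos : 0 < T%:R :> R by rewrite ltr0n.
  rewrite /prox_rate ler_pdivrMr ?mulr_gt0 ?addr_gt0 //.
  rewrite mulrCA -[m * _ * _]mulrA ler_pM2l //.
  have : (2 * b) ^+ 2 <= (a * T%:R) ^+ 2 by rewrite ler_sqr ?nnegrE ?mulr_ge0 // ltW.
  have : 0 <= a ^+ 2 * T%:R by rewrite mulr_ge0 // sqr_ge0.
  rewrite !exprMn; lra.
have KL : 32 * (m * a ^+ 2) <= m * (K%:R * (K%:R + 2)).
  rewrite mulrCA ler_pM2l //.
  have : (6 * a) ^+ 2 <= K%:R ^+ 2 by rewrite ler_sqr ?nnegrE ?mulr_ge0 // ltW.
  have := sqr_ge0 a; have : 0 <= K%:R :> R by [].
  rewrite exprMn; lra.
have [gap ncalls] := restarted_methodP q _ _ m df dh D T K J f h xs x0 L0 M0 m0 df0 dh0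
  isT isT isT rateL KL cf ch sc min x0D fG hG.
split.
- apply: le_trans gap _; rewrite lerD2l.
  have : 4 * (K%:R * df) <= 4 * (7 * a * df) by rewrite ler_pM2l // ler_wpM2r //; lra.
  have : K%:R * T%:R * dh <= 21 * b * dh by rewrite ler_wpM2r.
  lra.
- rewrite ncalls eqxx muln1 natrM.
  have -> : 21 * a * l = (2 * l + l) * (6 * a + a) by ring.
  by rewrite ler_pM.
- rewrite ncalls; have -> : (~~ q == q) = false by case: (q).
  rewrite !natrM.
  have -> : 63 * b * l = (2 * l + l) * (21 * b) by ring.
  by rewrite ler_pM // mulr_ge0.
Qed.

Lemma inexact_gradient_weaken (d L L' : R) f G : L <= L' ->
  inexact_gradient d L f G -> inexact_gradient d L' f G.
Proof.
move=> LL' fG x; have [fx fP] := fG x; exists fx => z.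
have /andP[-> up] := fP z; rewrite (le_trans up) // lerD2r.
by rewrite ler_wpM2r ?sqr_ge0 // ler_pM2r.
Qed.

(** The second difference [f e + f (- e) - 2 f 0] is at least [m |e|^2] and at most [L |e|^2]; a
    nonzero [e] requires positive dimension. *)
Lemma strongly_convex_le_smooth (m L : R) f G : (0 < n)%N ->
  strongly_convex m f -> inexact_gradient 0 L f G -> m <= L.
Proof.
move=> n0 sc fG; pose e : V := const_mx 1.
have e0 : 0 < dotp e e.
  rewrite /dotp (eq_bigr (fun=> 1)) => [|i _]; last by rewrite !mxE mulr1.
  by rewrite sumr_const card_ord ltr0n.
have [f0 fP] := fG 0.
have /andP[_ up] := fP e; have /andP[_ down] := fP (- e).
have /andP[lo _] := fP 0.
have h0 : 0 <= 2^-1 :> R by rewrite invr_ge0.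
have h1 : 2^-1 <= 1 :> R by rewrite invf_le1 // ler1n.
have := sc e (- e) 2^-1 (introT andP (conj h0 h1)).
have -> : 2^-1 *: e + (1 - 2^-1) *: - e = 0.
  rewrite scalerN -scalerBl; have -> : 2^-1 - (1 - 2^-1) = 0 :> R by field.
  by rewrite scale0r.
move=> mid; rewrite -(ler_pM2r e0); move: up down lo mid.
rewrite !subr0 !enorm2 !dotpE.
have -> x : dotp x 0 = 0 by rewrite -(scale0r x) dotpZr mul0r.
lra.
Qed.

End Tuning.

(** * Condition numbers and the logarithmic factor *)

Section Complexity.
Context {R : realType}.
Implicit Types (P : params R).

Definition max_sqrt_ratio P (L : R) : R := Num.max 1 (Num.sqrt (L / mu P)).

Lemma max_sqrt_ratio_ge1 P L : 1 <= max_sqrt_ratio P L.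
Proof. by rewrite le_max lexx. Qed.

(** Allows [L] to be replaced by a smoothness constant of the form [mu P * a ^+ 2] with [1 <= a], as
    the tuned method expects. *)
Lemma le_max_sqrt_ratio P L : 0 < L -> L <= mu P * max_sqrt_ratio P L ^+ 2.
Proof.
move=> L0; have m0 := mu_gt0 P; rewrite mulrC -ler_pdivrMr //.
have q0 : 0 <= L / mu P by rewrite divr_ge0 // ltW.
rewrite -[leLHS]sqr_sqrtr // ler_sqr ?nnegrE ?sqrtr_ge0 //.
  by rewrite le_max lexx orbT.
by rewrite (le_trans ler01) // max_sqrt_ratio_ge1.
Qed.

Lemma log_factor_terms_ge0 P :
  0 <= (Lr P + Lg P) / mu P /\ 0 <= (Lr P + Lg P) * D P ^+ 2 / eps P.
Proof.
have LL : 0 <= Lr P + Lg P by rewrite addr_ge0 // ltW // ?Lr_gt0 ?Lg_gt0.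
have m0 : 0 <= mu P by rewrite ltW // mu_gt0.
have e0 : 0 <= eps P by rewrite ltW // eps_gt0.
by split; rewrite divr_ge0 // mulr_ge0 // sqr_ge0.
Qed.

Lemma log_factor_ge1 P : 1 <= log_factor P.
Proof.
have [Y0 X0] := log_factor_terms_ge0 P.
by rewrite lerDl ln_ge0 // -addrA lerDl addr_ge0.
Qed.

(** As [expR (1 / 2) <= 2], at least [2 * log_factor P] halvings yield a factor of at least
    [expR (log_factor P)], which dominates each term inside the logarithm. *)
Lemma log_factor_phases P :
  (Lr P + Lg P) * D P ^+ 2 / eps P <= 2 ^+ nat_above (2 * log_factor P).
Proof.
have [Y0 X0] := log_factor_terms_ge0 P; have l1 := log_factor_ge1 P.
set X := _ / eps P in X0 *; set N := nat_above _.
have XE : X <= expR (log_factor P).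
  rewrite /log_factor -/X expRD lnK ?posrE; last by rewrite -addrA ltr_pwDl ?addr_ge0.
  apply: (@le_trans _ _ (1 + (Lr P + Lg P) / mu P + X)); first by rewrite lerDr addr_ge0.
  by rewrite ler_peMl ?(le_trans _ (expR_ge1Dx _)) ?lerDl // !addr_ge0.
have e2 : expR (2^-1 : R) <= 2.
  have : 2^-1 <= expR (- 2^-1 : R).
    by apply: le_trans (expR_ge1Dx _); lra.
  rewrite expRN lef_pV2 ?posrE ?expR_gt0 //.
apply: le_trans XE _.
have /andP[N2 _] : 2 * log_factor P <= N%:R <= 2 * log_factor P + 1.
  by rewrite nat_aboveP // mulr_ge0 // (le_trans ler01).
apply: (@le_trans _ _ (expR (2^-1 * N%:R))); first by rewrite ler_expR; lra.
by rewrite expRM_natr lerXn2r ?nnegrE ?expR_ge0.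
Qed.

End Complexity.

(** * From the tuned method to both assertions *)

Lemma strong_convexity_le_smoothness {R : realType} {n : nat} (P : params R)
    (x0 : 'rV[R]_n) r g xs :
  (0 < n)%N -> instance P x0 r g xs -> mu P <= Lr P + Lg P.
Proof.
move=> n0 [cr cg sr sg [sc|sc] _ _].
  have rG := smooth_convex_inexact_gradient _ _ 0 (Lr_gt0 P) (lexx 0) cr sr.
  by rewrite (le_trans (strongly_convex_le_smooth _ _ _ _ n0 sc rG)) // lerDl ltW // Lg_gt0.
have gG := smooth_convex_inexact_gradient _ _ 0 (Lg_gt0 P) (lexx 0) cg sg.
by rewrite (le_trans (strongly_convex_le_smooth _ _ _ _ n0 sc gG)) // lerDr ltW // Lr_gt0.
Qed.

Lemma accuracy_after_phases {R : realType} {n : nat} (P : params R)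
    (x0 : 'rV[R]_n) r g xs xhat err :
  instance P x0 r g xs ->
  r xhat + g xhat - (r xs + g xs) <=
    mu P / 4 * (D P ^+ 2 / 2 ^+ nat_above (2 * log_factor P)) + err ->
  err <= eps P / 2 ->
  r xhat + g xhat - (r xs + g xs) <= eps P.
Proof.
move=> inst gap err_le; have e0 := eps_gt0 P.
(* In dimension 0 nothing bounds [mu P] by the smoothness constants, but there is only one point.
   Otherwise [mu P * D P ^+ 2] is charged to the logarithmic factor. *)
have [n0|n_gt0] := posnP n.
  have -> : xhat = xs by apply/rowP => i; have := ltn_ord i; rewrite [leqRHS]n0.
  by rewrite subrr ltW.
have m_le := strong_convexity_le_smoothness P x0 r g xs n_gt0 inst.
have := log_factor_phases P; set N := 2 ^+ _ in gap *.
have N0 : 0 < N by rewrite exprn_gt0.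
rewrite ler_pdivrMr // => phases.
have : mu P / 4 * (D P ^+ 2 / N) <= eps P / 4.
  rewrite mulrA ler_pdivrMr // [mu P / 4 * _]mulrAC [eps P / 4 * _]mulrAC.
  rewrite ler_pM2r // [eps P * _]mulrC (le_trans _ phases) //.
  by rewrite ler_wpM2r // sqr_ge0.
lra.
Qed.

Lemma inexact_sliding_method {R : realType} (c1 c2 : R) : 0 < c1 -> 0 < c2 ->
  exists (C : R) (p : nat), [/\ 0 < C, (p <= 2)%N &
    forall (n : nat) (P : params R) (x0 : 'rV[R]_n),
    exists m : method 'rV[R]_n,
    forall (r g : 'rV[R]_n -> R) (xs : 'rV[R]_n) (G : 'rV[R]_n -> 'rV[R]_n),
      instance P x0 r g xs ->
      inexact_gradient (c1 * (eps P / N_g C p P)) (c2 * Lg P) g G ->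
      succeeds C p P r g xs G m].
Proof.
move=> c10 c20; pose sg : R := Num.max 1 c2.
have sg1 : 1 <= sg by rewrite le_max lexx.
have sgc2 : c2 <= sg by rewrite le_max lexx orbT.
have sg0 : 0 < sg by apply: lt_le_trans sg1.
(* The admissible error depends on [C] through [N_g]. The factor [1 + c1] makes the accumulated
   error [84 * rg * delta] at most [eps P / 2], with 168 twice 84; [sg] pays for the enlarged
   constant [c2 * Lg P]. *)
pose C := 168 * sg * (1 + c1).
have C0 : 0 < C by rewrite !mulr_gt0 // addr_gt0.
exists C, 1%N; split=> // n P x0.
have m0 := mu_gt0 P; have e0 := eps_gt0 P.
have l1 := log_factor_ge1 P; set l := log_factor P in l1.
have l0 : 0 < l by apply: lt_le_trans l1.
pose rr := max_sqrt_ratio P (Lr P); pose rg0 := max_sqrt_ratio P (Lg P).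
pose rg := sg * rg0.
have rr1 : 1 <= rr := max_sqrt_ratio_ge1 _ _.
have rg01 : 1 <= rg0 := max_sqrt_ratio_ge1 _ _.
have rg00 : 0 < rg0 by apply: lt_le_trans rg01.
have rg1 : 1 <= rg by rewrite -[1]mulr1 ler_pM.
have LrE : Lr P <= mu P * rr ^+ 2 by apply: le_max_sqrt_ratio; exact: Lr_gt0.
have LgE : c2 * Lg P <= mu P * rg ^+ 2.
  rewrite /rg exprMn mulrCA ler_pM ?(ltW c20) ?(ltW (Lg_gt0 P)) //.
    by rewrite (le_trans sgc2) // expr2 ler_peMr // ltW.
  by apply: le_max_sqrt_ratio; exact: Lg_gt0.
have NgE : N_g C 1 P = C * rg0 * l by rewrite /N_g /Otilde_sqrt expr1.
have NrE : N_r C 1 P = C * rr * l by rewrite /N_r /Otilde_sqrt expr1.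
set delta := c1 * (eps P / N_g C 1 P).
have Ng0 : 0 < N_g C 1 P by rewrite NgE mulr_gt0 // mulr_gt0.
have delta0 : 0 <= delta by rewrite ltW // mulr_gt0 // divr_gt0.
have err : 84 * rg * delta <= eps P / 2.
  rewrite /delta !mulrA ler_pdivrMr // NgE /rg /C.
  have -> : 84 * sg * rg0 * c1 * eps P = 84 * sg * rg0 * eps P * (c1 * 1) by ring.
  have -> : eps P / 2 * (168 * sg * (1 + c1) * rg0 * l) =
    84 * sg * rg0 * eps P * ((1 + c1) * l) by field.
  by rewrite ler_wpM2l ?mulr_ge0 ?ler_pM // ?ler_wpDl // ltW.
have Crr k : k <= 63 -> k * rr * l <= N_r C 1 P.
  move=> k63; rewrite NrE ler_wpM2r ?(ltW l0) // ler_wpM2r ?(le_trans ler01) //.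
  by rewrite (le_trans k63) // /C; nra.
have Crg k : k <= 63 -> k * rg * l <= N_g C 1 P.
  move=> k63; rewrite NgE /rg ler_wpM2r ?(ltW l0) // mulrA ler_wpM2r ?(ltW rg00) //.
  rewrite (@le_trans _ _ (63 * sg)) ?ler_wpM2r ?(ltW sg0) // /C; nra.
have role_r r g xs : instance P x0 r g xs ->
    inexact_gradient 0 (mu P * rr ^+ 2) r (grad r).
  move=> [cr _ sr _ _ _ _]; apply: inexact_gradient_weaken LrE _.
  by apply: smooth_convex_inexact_gradient => //; exact: Lr_gt0.
(* The smaller constant decides which function is linearized in the outer loop; the choice depends
   on [P] and [c2] only, so the method is fixed before the functions. *)
have [ab|/ltW ba] := leP rr rg.
- exists (tuned_method true (mu P) rr rg l x0) => r g xs G inst gG.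
  have rG := role_r _ _ _ inst; have := inst; case=> cr cg _ _ sc min dist.
  have {}gG := inexact_gradient_weaken _ _ _ _ _ LgE gG.
  have [gap nr ng] := tuned_methodP (grad r) G true (mu P) rr rg l 0 delta (D P) r g xs x0
    m0 rr1 ab l1 (lexx 0) delta0 cr cg sc min dist rG gG.
  split; last 2 first.
  + by apply: le_trans nr _; apply: Crr; lra.
  + by apply: le_trans ng _; apply: Crg; lra.
  by apply: accuracy_after_phases inst gap _; rewrite mulr0 add0r.
- exists (tuned_method false (mu P) rg rr l x0) => r g xs G inst gG.
  have rG := role_r _ _ _ inst; have := inst; case=> cr cg _ _ sc min dist.
  have {}gG := inexact_gradient_weaken _ _ _ _ _ LgE gG.
  have minC x : g xs + r xs <= g x + r x by rewrite addrC [leRHS]addrC.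
  have [gap ng nr] := tuned_methodP (grad r) G false (mu P) rg rr l delta 0 (D P) g r xs x0
    m0 rg1 ba l1 delta0 (lexx 0) cg cr ((iffLR (or_comm _ _)) sc) minC dist gG rG.
  split; last 2 first.
  + by apply: le_trans nr _; apply: Crr; lra.
  + by apply: le_trans ng _; apply: Crg; lra.
  apply: accuracy_after_phases inst _ _.
    by rewrite (addrC (r (output _ _ _))) (addrC (r xs)); exact: gap.
  rewrite mulr0 addr0 (le_trans _ err) // ler_wpM2r // ler_wpM2r ?(le_trans ler01) //.
  by rewrite ler_nat.
Qed.

Theorem mainTheorem4 (R : realType) :
  (exists (C : R) (p : nat), [/\ 0 < C, (p <= 2)%N &
     forall (n : nat) (P : params R) (x0 : 'rV[R]_n),
     exists m : method 'rV[R]_n,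
     forall (r g : 'rV[R]_n -> R) (xs : 'rV[R]_n),
       instance P x0 r g xs -> succeeds C p P r g xs (grad g) m])
  /\
  (forall c1 c2 : R, 0 < c1 -> 0 < c2 ->
   exists (C : R) (p : nat), [/\ 0 < C, (p <= 2)%N &
     forall (n : nat) (P : params R) (x0 : 'rV[R]_n),
     exists m : method 'rV[R]_n,
     forall (r g : 'rV[R]_n -> R) (xs : 'rV[R]_n) (G : 'rV[R]_n -> 'rV[R]_n),
       instance P x0 r g xs ->
       inexact_gradient (c1 * (eps P / N_g C p P)) (c2 * Lg P) g G ->
       succeeds C p P r g xs G m]).
Proof.
split; last exact: inexact_sliding_method.
(* The exact gradient is an inexact one for every nonnegative error, so the case [c1 = c2 = 1]
   suffices. *)
have [C [p [C0 p2 methodP]]] := @inexact_sliding_method R 1 1 ltr01 ltr01.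
exists C, p; split=> // n P x0; have [m mP] := methodP n P x0.
exists m => r g xs inst; apply: mP (inst) _.
rewrite !mul1r; case: inst => _ cg _ sg _ _ _.
have l0 : 0 < log_factor P := lt_le_trans ltr01 (log_factor_ge1 P).
apply: smooth_convex_inexact_gradient => //; first exact: Lg_gt0.
rewrite divr_ge0 ?(ltW (eps_gt0 P)) // /N_g /Otilde_sqrt.
rewrite !mulr_ge0 ?(ltW C0) ?exprn_ge0 ?(ltW l0) //.
Qed.
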